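(* Let $\mathcal{C}$ be an $[n,k,d]$-linear code over a field $\mathbb{K}$ with $\Sigma_{\mathcal{C}}=(\ell_1,\ldots,\ell_n)\subset R=\mathbb{K}[x_1,\ldots,x_k]$, and let $\mathrm{cf}(\mathcal{C})=\prod_{i=1}^n\ell_i$ be its Chow form. If $\mathrm{char}(\mathbb{K})>n$ or $\mathrm{char}(\mathbb{K})=0$, then $$d\ge \alpha\big(\mathrm{Ann}(\mathrm{cf}(\mathcal{C}))\big)-1.$$
   Context: An $[n,k,d]$-linear code $\mathcal{C}$ over a field $\mathbb{K}$ is the image of an injective linear map $\mathbb{K}^k\to\mathbb{K}^n$, $\mathbf{x}\mapsto \mathbf{x}G$, where $G=(a_{ij})$ is a $k\times n$ matrix of rank $k\ge 1$ (a generating matrix); $d$ is the smallest number of nonzero entries in a nonzero element of $\mathcal{C}$. $\Sigma_{\mathcal{C}}$ is the collection of linear forms dual to the columns of $G$: $\ell_j=\sum_{i=1}^k a_{ij}x_i$. Let $\partial(V)=\mathbb{K}[\partial_1,\ldots,\partial_k]$ be the polynomial ring in $\partial_i=\partial/\partial x_i$, acting on $R$ by differentiation ($\partial_i(x_j)=\delta_{i,j}$, extended by linearity and the Leibniz rule). For a homogeneous $P\in R$, $\mathrm{Ann}(P)=\{\theta\in\partial(V):\theta P=0\}$, a homogeneous ideal of $\partial(V)$ (standard grading). For a graded module $M=\bigoplus_{i\ge0}M_i$, $\alpha(M)$ is the smallest $i$ with $M_i\neq0$. *)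

(* Defs.v *)
From mathcomp Require Import all_boot all_order all_algebra.
From mathcomp Require Import mpoly.
From Stdlib Require Import ClassicalEpsilon.

Set Implicit Arguments.
Unset Strict Implicit.
Unset Printing Implicit Defensive.

Import GRing.Theory.
Local Open Scope ring_scope.

Definition is_least (p : nat -> Prop) (m : nat) : Prop :=
  p m /\ forall j : nat, p j -> (m <= j)%N.

(* Unspecified value when [p] is empty. *)
Definition least (p : nat -> Prop) : nat := epsilon (inhabits 0%N) (is_least p).

Section Code.
Variables (K : fieldType) (k n : nat) (G : 'M[K]_(k, n)).

Definition code (c : 'rV[K]_n) : Prop := exists x : 'rV[K]_k, c = x *m G.

Definition hweight (c : 'rV[K]_n) : nat := #|[set j | c 0 j != 0]|.

Definition linear_code (d : nat) : Prop :=
  [/\ (1 <= k)%N, \rank G = k &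
      is_least (fun w => exists c, [/\ code c, c != 0 & hweight c = w]) d].

Definition code_forms : n.-tuple {mpoly K[k]} :=
  [tuple \sum_(i < k) G i j *: 'X_i | j < n].

Definition chow_form : {mpoly K[k]} := \prod_(l <- code_forms) l.

End Code.

Section Annihilator.
Variables (K : fieldType) (k : nat).

(* The operator ring K[d_1, ..., d_k] is represented by {mpoly K[k]} itself,
   with 'X_i standing for the derivation d_i. *)
Definition diff_act (theta P : {mpoly K[k]}) : {mpoly K[k]} :=
  \sum_(m <- msupp theta) theta@_m *: P^`M[m].

Definition Ann (P theta : {mpoly K[k]}) : Prop := diff_act theta P = 0.

(* For a graded submodule M of {mpoly K[k]}, the component M_i consists of the
   elements of M that are homogeneous of degree i. *)
Definition alpha (M : {mpoly K[k]} -> Prop) : nat :=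
  least (fun i => exists theta, [/\ M theta, theta \is i.-homog & theta != 0]).

End Annihilator.

Lemma leastP (p : nat -> Prop) : (exists i, p i) -> is_least p (least p).
Proof.
move=> [i pi]; apply: epsilon_spec.
pose q j : bool := if excluded_middle_informative (p j) then true else false.
have qP j : reflect (p j) (q j).
  by rewrite /q; case: excluded_middle_informative => h; constructor.
have exq : exists j, q j by exists i; apply/qP.
case: (ex_minnP exq) => m /qP pm min_m.
by exists m; split=> // j /qP; apply: min_m.
Qed.

Lemma diff_actX (K : fieldType) (k : nat) (m : 'X_{1..k}) (P : {mpoly K[k]}) :
  diff_act 'X_[m] P = P^`M[m].
Proof. by rewrite /diff_act msuppX big_seq1 mcoeffX eqxx scale1r. Qed.

(* For k >= 1 the set minimised in [alpha (Ann P)] is never empty. *)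
Lemma alpha_AnnP (K : fieldType) (k : nat) (P : {mpoly K[k]}) : (1 <= k)%N ->
  is_least (fun i => exists theta : {mpoly K[k]},
    [/\ Ann P theta, theta \is i.-homog & theta != 0]) (alpha (Ann P)).
Proof.
case: k P => // k P _; apply: leastP.
pose m : 'X_{1..k.+1} := (U_(ord0) *+ msize P)%MM.
exists (mdeg m), 'X_[m]; split; last 2 first.
- by rewrite dhomogX.
- by rewrite -msupp_eq0 msuppX.
rewrite /Ann diff_actX; apply/mpolyP => m'; rewrite mcoeff_mderivm mcoeff0.
rewrite (memN_msupp_eq0 (m := (m + m')%MM)) ?mul0rn //.
apply: msize_mdeg_ge; rewrite mdegD mdegMn mdeg1 mul1n; exact: leq_addr.
Qed.

(* Main.v *)
Require Import Defs.
From HB Require Import structures.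
From mathcomp Require Import all_boot all_order all_algebra.
From mathcomp Require Import mpoly.
From mathcomp Require Import ssrcomplements.

(** Let [v *m G] be a codeword of minimal weight [d], and let [D] be the
    directional derivative along [v], that is, the operator attached to the
    linear form [theta = \sum_i v_i 'X_i].  On a linear form, [D] is evaluation
    at [v]; so [D] sends the form dual to column [j] of [G] to the [j]-th entry
    of the codeword, and exactly [d] factors of the Chow form have a nonzero
    derivative.  The other factors are constants for [D], and each of the [d]
    remaining ones can be differentiated only once: by the Leibniz rule,
    applying [D] to the product [d.+1] times gives [0]
    ([iter_derivation_prod0]).  As operators compose the way polynomials
    multiply ([diff_actM]), this says that [theta ^+ d.+1] annihilates the Chow
    form.  It is a nonzero homogeneous polynomial of degree [d.+1], whence
    [alpha (Ann (chow_form G)) <= d.+1]. *)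

Set Implicit Arguments.
Unset Strict Implicit.
Unset Printing Implicit Defensive.

Import GRing.Theory Num.Theory.
Local Open Scope ring_scope.

(** Call an element a constant if [D] kills it.  Each non-constant factor can
    absorb a single [D], so more applications of [D] than there
    are such factors leave nothing; no factorial is ever divided by, which is
    why this holds in every characteristic. *)
Lemma iter_derivation_prod0 (A : comNzRingType) (D : {additive A -> A})
    (s : seq A) :
  (forall a b, D (a * b) = D a * b + a * D b) ->
  {in s, forall l, D (D l) = 0} ->
  iter (count (fun l => D l != 0) s).+1 D (\prod_(l <- s) l) = 0.
Proof.
move=> Leibniz; elim: s => [|l s IHs] DD0.
  rewrite big_nil /=; apply: (addrI (D 1)).
  by rewrite addr0 -{3}[1]mulr1 Leibniz mulr1 mul1r.
have {}IHs : iter (count (fun l => D l != 0) s).+1 D (\prod_(l <- s) l) = 0.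
  by apply: IHs => x xs; apply: DD0; rewrite inE xs orbT.
(* Since [D l] is a constant, the Leibniz expansion has only two terms. *)
have iterDM m Q :
    iter m.+1 D (l * Q) = l * iter m.+1 D Q + D l * iter m D Q *+ m.+1.
  elim: m => [|m IHm]; first by rewrite /= Leibniz addrC mulr1n.
  rewrite iterS IHm raddfD raddfMn !Leibniz DD0 ?mem_head // mul0r add0r.
  by rewrite -!iterS [_ + l * _]addrC -addrA -mulrS.
rewrite big_cons /=; have [Dl0|_] := eqVneq (D l) 0.
  by rewrite add0n -iterS iterDM IHs Dl0 mul0r mul0rn mulr0 addr0.
by rewrite -iterS iterDM iterS IHs raddf0 !mulr0 mul0rn addr0.
Qed.

Section DiffAct.
Variables (K : fieldType) (k : nat).
Implicit Types (theta P : {mpoly K[k]}) (v : 'rV[K]_k).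

(** Summing over all monomials of bounded degree makes the index set common to
    several operators, so that they can be added termwise. *)
Lemma diff_actwE N theta P : (msize theta <= N)%N ->
  diff_act theta P = \sum_(m : 'X_{1..k < N}) theta@_m *: P^`M[m].
Proof.
move=> le_theta; pose I : subFinType _ := 'X_{1..k < N}.
rewrite /diff_act (big_mksub I) ?msupp_uniq //=; last first.
  by move=> m /msize_mdeg_lt/leq_trans; apply.
by rewrite big_rmcond //= => m /memN_msupp_eq0 ->; rewrite scale0r.
Qed.

Lemma diff_actPl c theta1 theta2 P :
  diff_act (c *: theta1 + theta2) P = c *: diff_act theta1 P + diff_act theta2 P.
Proof.
pose N := maxn (msize (c *: theta1 + theta2))
               (maxn (msize theta1) (msize theta2)).
rewrite !(@diff_actwE N) ?leq_max ?leqnn ?orbT // scaler_sumr -big_split /=.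
by apply: eq_bigr => m _; rewrite mcoeffD mcoeffZ scalerDl scalerA.
Qed.

Lemma diff_act0l P : diff_act 0 P = 0.
Proof. by rewrite /diff_act msupp0 big_nil. Qed.

Lemma diff_actZl c theta P : diff_act (c *: theta) P = c *: diff_act theta P.
Proof. by rewrite -[c *: theta]addr0 diff_actPl diff_act0l addr0. Qed.

Lemma diff_act_suml (I : Type) (r : seq I) (F : I -> {mpoly K[k]}) P :
  diff_act (\sum_(i <- r) F i) P = \sum_(i <- r) diff_act (F i) P.
Proof.
apply: (big_morph (fun theta => diff_act theta P) _ (diff_act0l P)).
by move=> theta1 theta2; rewrite -[theta1]scale1r diff_actPl !scale1r.
Qed.

Lemma diff_act_is_linearr theta : linear (diff_act theta).
Proof.
move=> c P Q; rewrite /diff_act scaler_sumr -big_split /=.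
by apply: eq_bigr => m _; rewrite linearP scalerDr !scalerA mulrC.
Qed.

HB.instance Definition _ theta :=
  GRing.isLinear.Build K {mpoly K[k]} {mpoly K[k]}
  _ (diff_act theta) (diff_act_is_linearr theta).

Lemma diff_actXM m theta P :
  diff_act ('X_[m] * theta) P = (diff_act theta P)^`M[m].
Proof.
rewrite {1}[theta]mpolyE mulr_sumr diff_act_suml /diff_act raddf_sum /=.
apply: eq_bigr => m' _; rewrite -/(diff_act _ _) -scalerAr diff_actZl.
by rewrite -mpolyXD diff_actX mderivmZ addmC mderivmDm.
Qed.

(** The polynomial ring acts as a ring of operators because partial derivatives
    commute. *)
Lemma diff_actM theta1 theta2 P :
  diff_act (theta1 * theta2) P = diff_act theta1 (diff_act theta2 P).
Proof.
rewrite {1}[theta1]mpolyE mulr_suml diff_act_suml [RHS]/diff_act.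
by apply: eq_bigr => m _; rewrite -scalerAl diff_actZl diff_actXM.
Qed.

Lemma diff_act_exp theta e P :
  diff_act (theta ^+ e) P = iter e (diff_act theta) P.
Proof.
elim: e => [|e IHe]; last by rewrite exprS diff_actM IHe.
by rewrite expr0 -mpolyX0 diff_actX mderivm0m.
Qed.

Definition linform v : {mpoly K[k]} := \sum_(i < k) v 0 i *: 'X_i.

Lemma mcoeff_linform v i : (linform v)@_U_(i) = v 0 i.
Proof.
rewrite raddf_sum (bigD1 i) //= mcoeffZ mcoeffXU eqxx mulr1 big1 ?addr0 // => j.
by move=> /negPf ji; rewrite mcoeffZ mcoeffXU ji mulr0.
Qed.

Lemma linform_eq0 v : (linform v == 0) = (v == 0).
Proof.
apply/eqP/eqP => [v0 | ->].
  by apply/rowP => i; rewrite -mcoeff_linform v0 mcoeff0 mxE.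
by rewrite /linform big1 // => i _; rewrite mxE scale0r.
Qed.

Lemma linform_homog v : linform v \is 1.-homog.
Proof. by apply: rpred_sum => i _; apply: rpredZ; rewrite dhomogX /= mdeg1. Qed.

Lemma diff_act_linform v P :
  diff_act (linform v) P = \sum_(i < k) v 0 i *: P^`M(i).
Proof.
rewrite diff_act_suml; apply: eq_bigr => i _.
by rewrite diff_actZl diff_actX mderivmU1m.
Qed.

Lemma diff_act_linformM v P Q :
  diff_act (linform v) (P * Q) =
  diff_act (linform v) P * Q + P * diff_act (linform v) Q.
Proof.
rewrite !diff_act_linform mulr_suml mulr_sumr -big_split /=.
by apply: eq_bigr => i _; rewrite mderivM scalerDr scalerAl scalerAr.
Qed.

Lemma diff_act_linform2 v w :
  diff_act (linform v) (linform w) = (\sum_(i < k) v 0 i * w 0 i)%:MP.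
Proof.
rewrite diff_act_linform raddf_sum; apply: eq_bigr => i _ /=.
rewrite mpolyCM mul_mpolyC; congr (_ *: _).
rewrite raddf_sum (bigD1 i) //= big1 ?addr0 => [|j ji].
  by rewrite mderivZ mderivX mnm1E eqxx scale1r -{1}[U_(i)%MM]add0m addmK
    mpolyX0 -mul_mpolyC mulr1.
by rewrite mderivZ mderivX mnm1E (negPf ji) scale0r scaler0.
Qed.

Lemma diff_act_linformC v c : diff_act (linform v) c%:MP = 0.
Proof.
by rewrite diff_act_linform big1 // => i _; rewrite mderivC scaler0.
Qed.

End DiffAct.

Lemma diff_act_code_forms (K : fieldType) (k n : nat) (G : 'M[K]_(k, n))
    (v : 'rV[K]_k) (j : 'I_n) :
  diff_act (linform v) (tnth (code_forms G) j) = ((v *m G) 0 j)%:MP.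
Proof.
rewrite tnth_mktuple mxE.
have -> : \sum_(i < k) G i j *: 'X_i = linform (col j G)^T.
  by apply: eq_bigr => i _; rewrite !mxE.
by rewrite diff_act_linform2; congr _%:MP; apply: eq_bigr => i _; rewrite !mxE.
Qed.

(** The weight of [v *m G] counts the factors of the Chow form that vary in the
    direction [v], and so bounds the number of times that their product can be
    differentiated along [v]. *)
Lemma Ann_chow_form_linform (K : fieldType) (k n : nat) (G : 'M[K]_(k, n))
    (v : 'rV[K]_k) :
  Ann (chow_form G) (linform v ^+ (hweight (v *m G)).+1).
Proof.
rewrite /Ann diff_act_exp.
have -> : hweight (v *m G) =
    count (fun l => diff_act (linform v) l != 0) (code_forms G).
  rewrite /hweight cardsE cardE /enum_mem size_filter.
  rewrite -[in RHS](map_tnth_enum (code_forms G)) count_map enumT.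
  by apply: eq_count => j /=; rewrite diff_act_code_forms mpolyC_eq0.
apply: (iter_derivation_prod0 (D := diff_act (linform v))).
  exact: diff_act_linformM.
by move=> _ /tnthP[j ->]; rewrite /= diff_act_code_forms diff_act_linformC.
Qed.

Theorem proposition3p1 (K : fieldType) (n k d : nat) (G : 'M[K]_(k, n)) :
  linear_code G d ->
  (exists2 p : nat, p \in [pchar K]%R & (n < p)%N) \/ [pchar K]%R =i pred0 ->
  (((alpha (Ann (chow_form G)))%:Z - 1)%R <= d%:Z)%R.
Proof.
move=> [k_gt0 _ [[_ [[v ->] vG_neq0 <-]] _]] _.
have [_ alpha_min] := alpha_AnnP (chow_form G) k_gt0.
set w := hweight _; rewrite lerBlDr -PoszD lez_nat addn1.
apply: alpha_min; exists (linform v ^+ w.+1); split.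
- exact: Ann_chow_form_linform.
- by rewrite -[X in X.-homog]mul1n; apply/dhomogMn/linform_homog.
- rewrite expf_neq0 // linform_eq0.
  by apply: contraNneq vG_neq0 => ->; rewrite mul0mx.
Qed.
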